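(* Let $d\ge 1$ be an arbitrary embedding dimension and let $\phi:\mathbb{R}\to\mathbb{R}$ be an activation function. For $L\ge 1$ let $\mathcal{F}_L$ be the set of all networks with $L$ hidden nodes, i.e. all functions $\mathbb{R}^{2d}\to\mathbb{R}$ of the form $x\mapsto\sum_{i=1}^{L}\phi(\langle w_i,x\rangle+b_i)\,\beta_i$ with $w_i\in\mathbb{R}^{2d}$ and $b_i,\beta_i\in\mathbb{R}$, and let $\mathcal{F}=\bigcup_{L=1}^{\infty}\mathcal{F}_L$ be the set of all possible networks. (1) Suppose $\mathcal{F}$ is dense in $C(\mathbb{R}^{2d})$. Then, given any ground truth in a knowledge graph with $\tau$ true facts, there exists a LogicENN in $\mathcal{F}$ with embedding dimension $d$ that can represent the ground truth. (2) The same holds when $\mathcal{F}$ is dense in $C(\Omega)$, where $\Omega=\Omega_{\mathcal{E}}\times\Omega_{\mathcal{E}}$ is the Cartesian product of two compact sets, $\Omega_{\mathcal{E}}\subset\mathbb{R}^d$ being the compact set in which the entity embedding vectors lie.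
   Context: A knowledge graph has a finite set of entities $\mathcal{E}$ and a finite set of relations $\mathcal{R}$; a fact (triple) is an element $(h,r,t)\in\mathcal{E}\times\mathcal{R}\times\mathcal{E}$. A ground truth is an assignment of True or False to every triple; $\tau$ is the number of true triples. Each entity $e\in\mathcal{E}$ has an embedding vector $\mathbf{e}\in\Omega_{\mathcal{E}}\subset\mathbb{R}^d$, and $\Omega_{\mathcal{E}}$ is assumed to be a compact set. A LogicENN with activation $\phi$ and embedding dimension $d$ consists of: an embedding vector for each entity; a number $L\ge1$ of hidden nodes with hidden-layer parameters $w_i\in\mathbb{R}^{2d}$, $b_i\in\mathbb{R}$ ($1\le i\le L$), shared by all entities and relations; and, for each relation $r$, an output weight vector (the relation embedding) $\beta^r=(\beta^r_1,\dots,\beta^r_L)\in\mathbb{R}^L$. The score of a triple $(h,r,t)$ is $$f^r_{h,t}=\sum_{i=1}^{L}\phi\big(\langle w_i,[\mathbf{h},\mathbf{t}]\rangle+b_i\big)\,\beta^r_i ,$$ where $[\mathbf{h},\mathbf{t}]\in\mathbb{R}^{2d}$ is the concatenation of the embeddings of $h$ and $t$. Thus for each $r$ the score is the value at $[\mathbf{h},\mathbf{t}]$ of a network in $\mathcal{F}$; ''a LogicENN in $\mathcal{F}$'' means a LogicENN of this form. A LogicENN represents a ground truth if its scores give the truth values of all triples, with True encoded as $1$ and False as $0$: $f^r_{h,t}=1$ for every true triple $(h,r,t)$ and $f^r_{h,t}=0$ for every false one. $C(X)$ is the set of continuous real-valued functions on $X$. Density in $C(\mathbb{R}^{2d})$ is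 with respect to uniform convergence on compact sets, and density in $C(\Omega)$ (of the restrictions to $\Omega$) is with respect to the supremum norm.
   Formalization: Where embeddings must lie in a given compact set Ω_E (part (2), and part (1) in that reading), Ω_E is assumed to have at least as many points as there are entities; otherwise the claim fails, e.g. Ω_E one point, φ = exp, two entities, (h,r,t) true iff h = t. *)

(* Defs.v *)
From mathcomp Require Import all_boot all_order all_algebra.
From mathcomp Require Import all_classical all_reals all_analysis.

Set Implicit Arguments.
Unset Strict Implicit.
Unset Printing Implicit Defensive.

Import Order.TTheory GRing.Theory Num.Theory.
Import numFieldNormedType.Exports.

Local Open Scope classical_set_scope.
Local Open Scope ring_scope.

Definition inner (R : realType) (n : nat) (w x : 'rV[R]_n) : R :=
  \sum_(j < n) w ord0 j * x ord0 j.

Definition network (R : realType) (phi : R -> R) (n L : nat)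
    (w : 'I_L -> 'rV[R]_n) (b beta : 'I_L -> R) (x : 'rV[R]_n) : R :=
  \sum_(i < L) phi (inner (w i) x + b i) * beta i.

Definition networksL (R : realType) (phi : R -> R) (n L : nat) :
    set ('rV[R]_n -> R) :=
  [set f | exists (w : 'I_L -> 'rV[R]_n) (b beta : 'I_L -> R),
             f = network phi w b beta].

Definition networks (R : realType) (phi : R -> R) (n : nat) :
    set ('rV[R]_n -> R) :=
  \bigcup_(L in [set L : nat | (0 < L)%N]) networksL phi L.

(* As [phi] need not be continuous, density of [F] in a space of continuous
   functions means that every continuous function is in the closure of [F];
   [F] itself is not required to consist of continuous functions. *)
Definition dense_in_C (R : realType) (n : nat) (F : set ('rV[R]_n -> R)) :
    Prop :=
  [set f : 'rV[R]_n -> R | continuous f]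
    `<=` closure (F : set {family compact, 'rV[R]_n -> R}).

(* Functions on [Omega] are represented by total functions, of which only the
   values on [Omega] are relevant, both to [{within Omega, continuous _}] and to
   the topology of uniform convergence on [Omega]. *)
Definition dense_in_C_on (R : realType) (n : nat) (Omega : set 'rV[R]_n)
    (F : set ('rV[R]_n -> R)) : Prop :=
  [set f : 'rV[R]_n -> R | {within Omega, continuous f}]
    `<=` closure (F : set {uniform` Omega -> R}).

Definition square (R : realType) (d : nat) (A : set 'rV[R]_d) :
    set 'rV[R]_(d + d) :=
  [set row_mx h t | h in A & t in A].

(* The hidden layer [hidden_w], [hidden_b] is shared by all relations. *)
Record LogicENN (R : realType) (d : nat) (Ent Rel : finType) := {
  emb : Ent -> 'rV[R]_d;
  width : nat;
  width_gt0 : (0 < width)%N;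
  hidden_w : 'I_width -> 'rV[R]_(d + d);
  hidden_b : 'I_width -> R;
  rel_emb : Rel -> 'I_width -> R
}.

Arguments hidden_w {R d Ent Rel} _ _.
Arguments hidden_b {R d Ent Rel} _ _.
Arguments rel_emb {R d Ent Rel} _ _ _.

Definition score (R : realType) (phi : R -> R) (d : nat) (Ent Rel : finType)
    (N : LogicENN R d Ent Rel) (h : Ent) (r : Rel) (t : Ent) : R :=
  network phi (hidden_w N) (hidden_b N) (rel_emb N r)
    (row_mx (emb N h) (emb N t)).

Definition represents (R : realType) (phi : R -> R) (d : nat)
    (Ent Rel : finType) (N : LogicENN R d Ent Rel)
    (truth : Ent * Rel * Ent -> bool) : Prop :=
  forall h r t, score phi N h r t = if truth (h, r, t) then 1 else 0.

Definition embeddings_in (R : realType) (d : nat) (Ent Rel : finType)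
    (N : LogicENN R d Ent Rel) (OmegaE : set 'rV[R]_d) : Prop :=
  forall e, OmegaE (emb N e).

(* Main.v *)
(* Only the values of networks at the finitely many distinct points [h, t] matter.
   By density, the indicator function of each of these points is approximated at all
   of them by a network; when the error is small, the matrix of values of these
   networks is close to the identity, hence invertible, so every assignment of values
   to the points is an exact linear combination of them. Juxtaposing their hidden
   layers gives one hidden layer serving all relations, the coefficients of
   the combination being absorbed into the output weights. *)
Require Import Defs.
From mathcomp Require Import all_boot all_order all_algebra.
From mathcomp Require Import all_classical all_reals all_analysis.

Set Implicit Arguments.
Unset Strict Implicit.
Unset Printing Implicit Defensive.

Import Order.TTheory GRing.Theory Num.Theory.
Import numFieldNormedType.Exports.

Local Open Scope classical_set_scope.
Local Open Scope ring_scope.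

Lemma near_identity_unitmx (R : realFieldType) (m : nat) (M : 'M[R]_m) :
  (forall i, \sum_j `|M i j - (i == j)%:R| < 1) -> M \in unitmx.
Proof.
move=> M1; rewrite -row_free_unit; apply: inj_row_free => v vM0.
pose r i := \sum_j `|M i j - (i == j)%:R|.
have vle : \sum_j `|v ord0 j| <= \sum_j `|v ord0 j| * r j.
  under [leRHS]eq_bigr do rewrite mulr_sumr.
  rewrite exchange_big; apply: ler_sum => j _ /=.
  under eq_bigr do rewrite -normrM mulrBr.
  apply: le_trans (ler_norm_sum _ _ _); rewrite sumrB.
  have := congr1 (fun u : 'rV_m => u ord0 j) vM0; rewrite !mxE => ->.
  rewrite sub0r normrN (bigD1 j) //= eqxx mulr1 big1 ?addr0 // => i /negbTE ->.
  by rewrite mulr0.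
have vr_ge0 i : true -> 0 <= `|v ord0 i| * (1 - r i).
  by move=> _; rewrite mulr_ge0 // subr_ge0 ltW ?M1.
have : \sum_i `|v ord0 i| * (1 - r i) == 0.
  rewrite eq_le sumr_ge0 // andbT.
  by under eq_bigr do rewrite mulrBr mulr1; rewrite sumrB subr_le0.
rewrite psumr_eq0 // => /allP v0; apply/rowP => i; rewrite mxE.
have /= := v0 i (mem_index_enum _).
by rewrite mulf_eq0 normr_eq0 subr_eq0 (gt_eqF (M1 i)) orbF => /eqP.
Qed.

Lemma exact_interpolation (R : realType) (phi : R -> R) (n m : nat)
    (p : 'I_m -> 'rV[R]_n) :
  (forall q, exists2 f, networks phi f &
     forall j, `|f (p j) - (q == j)%:R| < m.+1%:R^-1) ->
  exists (L : nat) (w : 'I_L -> 'rV[R]_n) (b : 'I_L -> R),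
    (0 < L)%N /\ forall y : 'I_m -> R, exists beta : 'I_L -> R,
      forall j, network phi w b beta (p j) = y j.
Proof.
case: m p => [|m] p approx.
  by exists 1%N, (fun=> 0), (fun=> 0); split=> // y; exists (fun=> 0) => -[].
pose net := {L : nat & (('I_L -> 'rV[R]_n) * ('I_L -> R) * ('I_L -> R))%type}.
pose eval (N : net) := let: existT _ (w, b, beta) := N in network phi w b beta.
have /choice[N NP] (q : 'I_m.+1) : exists N : net, (0 < tag N)%N /\
    forall j, `|eval N (p j) - (q == j)%:R| < m.+2%:R^-1.
  have [_ [L L0 [w [b [beta ->]]]] fq] := approx q.
  by exists (existT _ L (w, b, beta)).
pose M := \matrix_(q, j) eval (N q) (p j).
have Munit : M \in unitmx.
  apply: near_identity_unitmx => q.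
  apply: (@le_lt_trans _ _ (\sum_(j < m.+1) m.+2%:R^-1)).
    by apply: ler_sum => j _; rewrite mxE ltW ?(NP q).2.
  by rewrite sumr_const card_ord -[ltLHS]mulr_natl ltr_pdivrMr ?ltr0n // mul1r ltr_nat.
pose node := {q : 'I_m.+1 & 'I_(tag (N q))}.
pose w (k : node) := (tagged (N (tag k))).1.1 (tagged k).
pose b (k : node) := (tagged (N (tag k))).1.2 (tagged k).
pose beta (k : node) := (tagged (N (tag k))).2 (tagged k).
exists #|{: node}|, (w \o enum_val), (b \o enum_val); split.
  by apply/card_gt0P; exists (Tagged (fun q => 'I_(tag (N q))) (Ordinal (NP ord0).1)).
move=> y; pose c := \row_j y j *m invmx M.
exists (fun k => c ord0 (tag (enum_val k)) * beta (enum_val k)) => j.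
have -> : y j = (c *m M) ord0 j by rewrite mulmxKV // mxE.
rewrite mxE /network -(big_enum_val (A := {: node})
  (fun k => phi (inner (w k) (p j) + b k) * (c ord0 (tag k) * beta k))) /=.
under eq_bigr do rewrite mulrCA.
rewrite -(@sig_big_dep _ _ _ _ (fun q => 'I_(tag (N q))) xpredT (fun _ => xpredT)
  (fun q i => c ord0 q * (phi (inner ((tagged (N q)).1.1 i) (p j)
     + (tagged (N q)).1.2 i) * (tagged (N q)).2 i))) /=.
apply: eq_bigr => q _; rewrite -mulr_sumr [M _ _]mxE; congr (_ * _).
by case: (N q) => L [[w0 b0] beta0].
Qed.

Lemma continuous_separation (R : realType) (V : normedModType R) (m : nat)
    (p : 'I_m -> V) (q : 'I_m) : injective p ->
  exists2 f : V -> R, continuous f & forall j, f (p j) = (q == j)%:R.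
Proof.
move=> p_inj; exists (fun x => \prod_(j | j != q) (`|x - p j| / `|p q - p j|)).
  move=> x; apply: (continuous_big mul_continuous) => j _ {}x.
  apply: cvgM; last exact: cvg_cst.
  by apply: cvg_norm; apply: cvgB; [exact: cvg_id|exact: cvg_cst].
move=> j; have [<-|qj] := eqVneq q j; last first.
  by rewrite (bigD1 j) 1?eq_sym //= subrr normr0 !mul0r.
rewrite big1 // => i iq; rewrite divff // normr_eq0 subr_eq0.
by apply: contraNneq iq => /p_inj ->.
Qed.

Lemma exists_representing (R : realType) (d : nat) (phi : R -> R)
    (Ent Rel : finType) (truth : Ent * Rel * Ent -> bool) (e : Ent -> 'rV[R]_d) :
  injective e ->
  (forall (f : 'rV[R]_(d + d) -> R) (eps : R), continuous f -> 0 < eps ->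
     exists2 g, networks phi g &
       forall h t, `|f (row_mx (e h) (e t)) - g (row_mx (e h) (e t))| < eps) ->
  exists2 N : LogicENN R d Ent Rel, emb N = e & represents phi N truth.
Proof.
move=> e_inj approx.
pose p (k : 'I_#|{: Ent * Ent}|) :=
  row_mx (e (enum_val k).1) (e (enum_val k).2).
have p_inj : injective p.
  move=> k l /eq_row_mx[/e_inj kl1 /e_inj kl2]; apply: enum_val_inj.
  by rewrite [LHS]surjective_pairing kl1 kl2 -surjective_pairing.
have [q|L [w [b [L0 interp]]]] := exact_interpolation (phi := phi) (p := p).
  have [f f_cont fp] := continuous_separation q p_inj.
  have [//||g gF fg] := approx f #|{: Ent * Ent}|.+1%:R^-1.
    by rewrite invr_gt0 ltr0n.
  by exists g => // j; rewrite -fp distrC; exact: fg.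
have /choice[beta betaP] (r : Rel) := interp (fun k =>
  (truth ((enum_val k).1, r, (enum_val k).2))%:R).
exists (Build_LogicENN e L0 w b beta) => // h r t.
have := betaP r (enum_rank (h, t)).
by rewrite /p enum_rankK /score /= => ->; case: (truth _).
Qed.

Lemma dense_in_C_approx (R : realType) (n : nat) (F : set ('rV[R]_n -> R))
    (A : set 'rV[R]_n) (f : 'rV[R]_n -> R) (eps : R) :
  dense_in_C F -> compact A -> continuous f -> 0 < eps ->
  exists2 g, F g & forall x, A x -> `|f x - g x| < eps.
Proof.
move=> Fdense cA f_cont eps0.
have [g [Fg fg]] := Fdense f f_cont _ (fam_nbhs f (entourage_ball R (PosNum eps0)) cA).
by exists g.
Qed.

Lemma dense_in_C_on_approx (R : realType) (n : nat) (F : set ('rV[R]_n -> R))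
    (A : set 'rV[R]_n) (f : 'rV[R]_n -> R) (eps : R) :
  dense_in_C_on A F -> {within A, continuous f} -> 0 < eps ->
  exists2 g, F g & forall x, A x -> `|f x - g x| < eps.
Proof.
move=> Fdense f_cont eps0.
have [|g [Fg fg]] := Fdense f f_cont
  [set g | forall x, A x -> `|f x - g x| < eps].
  apply/uniform_nbhs; exists [set xy | ball xy.1 eps xy.2].
  by split; first exact: (entourage_ball R (PosNum eps0)).
by exists g.
Qed.

Lemma exists_embedding (R : realType) (d : nat) (Ent : finType)
    (A : set 'rV[R]_d) : ([set: Ent] #<= A)%card ->
  exists2 e : Ent -> 'rV[R]_d, injective e & forall x, A (e x).
Proof.
case/pcard_leP => e; exists e; first by move=> x y; apply: inj; rewrite inE.
by move=> x; exact: funS.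
Qed.

Theorem theorem1 (R : realType) (d : nat) (d_ge1 : (1 <= d)%N) (phi : R -> R)
    (Ent Rel : finType) (truth : Ent * Rel * Ent -> bool) (tau : nat)
    (truth_tau : #|[set x : Ent * Rel * Ent | truth x]%SET| = tau) :
  (dense_in_C (networks phi (n := d + d)) ->
    (exists N : LogicENN R d Ent Rel, represents phi N truth) /\
    (forall OmegaE : set 'rV[R]_d,
       compact OmegaE -> ([set: Ent] #<= OmegaE)%card ->
       exists N : LogicENN R d Ent Rel,
         embeddings_in N OmegaE /\ represents phi N truth)) /\
  (forall OmegaE : set 'rV[R]_d,
     compact OmegaE -> ([set: Ent] #<= OmegaE)%card ->
     dense_in_C_on (square OmegaE) (networks phi (n := d + d)) ->
     exists N : LogicENN R d Ent Rel,
       embeddings_in N OmegaE /\ represents phi N truth).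
Proof.
split=> [dense|OmegaE _ /exists_embedding[e e_inj eO] dense].
  have dense_rep (e : Ent -> 'rV[R]_d) : injective e ->
      exists2 N : LogicENN R d Ent Rel, emb N = e & represents phi N truth.
    move=> e_inj; apply: exists_representing => // f eps f_cont eps0.
    pose A := range (fun ht : Ent * Ent => row_mx (e ht.1) (e ht.2)).
    have cA : compact A by apply: finite_compact; exact: finite_image.
    have [g gF fg] := dense_in_C_approx dense cA f_cont eps0.
    by exists g => // h t; apply: fg; exists (h, t).
  split=> [|OmegaE _ /exists_embedding[e /dense_rep[N Ne Nrep] eO]].
    have [|N _ Nrep] := dense_rep (fun x => const_mx (enum_rank x)%:R).
      case: d d_ge1 {dense dense_rep} => // d' _ x y.
      move=> /matrixP /(_ ord0 ord0); rewrite !mxE => /eqP.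
      by rewrite eqr_nat => /eqP /ord_inj /enum_rank_inj.
    by exists N.
  by exists N; split=> // x; rewrite Ne.
have [f eps f_cont eps0|N Ne Nrep] := exists_representing (phi := phi) truth e_inj.
  have [g gF fg] :=
    dense_in_C_on_approx dense (continuous_subspaceT f_cont) eps0.
  by exists g => // h t; apply: fg; exists (e h) => //; exists (e t).
by exists N; split=> // x; rewrite Ne.
Qed.
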